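(* Let $\mathcal{G}=(A,B,\mathbf{r},\mathbf{j},r_{\mathrm{ave}},j_{\mathrm{ave}})$ be a constrained bimatrix game with $A,B\in\mathbb{R}^{m\times n}$. A strategy pair $(\mathbf{x}^*,\mathbf{y}^* )$ is a Nash equilibrium of $\mathcal{G}$ if and only if there exist scalars $u^*,v^*\ge 0$ and $\alpha^*,\beta^*\in\mathbb{R}$ such that $(\mathbf{x}^*,\mathbf{y}^*,u^*,v^*,\alpha^*,\beta^* )$ is a global maximizer of the quadratic program $$\underset{\mathbf{x},\mathbf{y},u,v,\alpha,\beta}{\text{maximize}}\quad \mathbf{x}^T(A+B)\,\mathbf{y}-u\,r_{\mathrm{ave}}-v\,j_{\mathrm{ave}}-\alpha-\beta$$ subject to $$A\mathbf{y}-u\,\mathbf{r}-\alpha\mathbf{1}\le\mathbf{0},\quad B^T\mathbf{x}-v\,\mathbf{j}-\beta\mathbf{1}\le\mathbf{0},\quad \mathbf{r}^T\mathbf{x}\le r_{\mathrm{ave}},\quad \mathbf{j}^T\mathbf{y}\le j_{\mathrm{ave}},$$ $$\mathbf{1}^T\mathbf{x}=1,\quad \mathbf{1}^T\mathbf{y}=1,\quad \mathbf{x}\ge\mathbf{0},\ \mathbf{y}\ge\mathbf{0},\ u\ge 0,\ v\ge 0,\ \alpha,\beta\in\mathbb{R},$$ where $\mathbf{x}\in\mathbb{R}^m$, $\mathbf{y}\in\mathbb{R}^n$, vector inequalities are componentwise, and $\mathbf{1}$ is the all-ones vector of the appropriate size.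
   Context: A constrained bimatrix game $\mathcal{G}=(A,B,\mathbf{r},\mathbf{j},r_{\mathrm{ave}},j_{\mathrm{ave}})$ consists of payoff matrices $A,B\in\mathbb{R}^{m\times n}$ (for players I and II), vectors $\mathbf{r}=(r_1,\dots,r_m)^T$ with $0\le r_1<\dots<r_m$ and $\mathbf{j}=(j_1,\dots,j_n)^T$ with $0\le j_1<\dots<j_n$, and real numbers $r_{\mathrm{ave}},j_{\mathrm{ave}}$. It is assumed that $r_{\mathrm{ave}}<\max_i r_i$ or $j_{\mathrm{ave}}<\max_k j_k$. The feasible mixed strategies are $$\widehat{\mathbf{X}}=\{\mathbf{x}\in\mathbb{R}^m_+ : \textstyle\sum_i x_i=1,\ \mathbf{r}^T\mathbf{x}\le r_{\mathrm{ave}}\},\qquad \widehat{\mathbf{Y}}=\{\mathbf{y}\in\mathbb{R}^n_+ : \textstyle\sum_k y_k=1,\ \mathbf{j}^T\mathbf{y}\le j_{\mathrm{ave}}\}.$$ A pair $(\mathbf{x}^*,\mathbf{y}^* )$ is a Nash equilibrium (equilibrium pair) of $\mathcal{G}$ if $\mathbf{x}^*\in\widehat{\mathbf{X}}$, $\mathbf{y}^*\in\widehat{\mathbf{Y}}$, $\mathbf{x}^*$ maximizes $\mathbf{x}^TA\,\mathbf{y}^*$ over $\mathbf{x}\in\widehat{\mathbf{X}}$, and $\mathbf{y}^*$ maximizes ${\mathbf{x}^*}^TB\,\mathbf{y}$ over $\mathbf{y}\in\widehat{\mathbf{Y}}$. A global maximizer is a feasible point whose objective value is at least that of every other feasible point.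 *)

(* Defs.v *)
From mathcomp Require Import all_boot all_order all_algebra.
From mathcomp Require Import classical_sets reals.

Set Implicit Arguments.
Unset Strict Implicit.
Unset Printing Implicit Defensive.

Import Order.TTheory GRing.Theory Num.Theory.
Local Open Scope classical_set_scope.
Local Open Scope ring_scope.

Definition dotv (R : realType) (k : nat) (a b : 'cV[R]_k) : R :=
  (a^T *m b) 0 0.

Definition bilin (R : realType) (m n : nat)
  (x : 'cV[R]_m) (M : 'M[R]_(m, n)) (y : 'cV[R]_n) : R :=
  (x^T *m M *m y) 0 0.

Definition lev (R : realType) (k : nat) (a b : 'cV[R]_k) : Prop :=
  forall i : 'I_k, a i 0 <= b i 0.

Definition ones (R : realType) (k : nat) : 'cV[R]_k := const_mx 1.

Definition global_maximizer (R : realType) (T : Type)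
  (S : set T) (f : T -> R) (p : T) : Prop :=
  S p /\ forall q : T, S q -> f q <= f p.

(* The entries of [cg_r] and [cg_j] are nonnegative, so the default value 0 of
   the two maxima in [cg_active] does not affect them. *)
Record constrained_game (R : realType) (m n : nat) := ConstrainedGame {
  cg_A : 'M[R]_(m, n);
  cg_B : 'M[R]_(m, n);
  cg_r : 'cV[R]_m;
  cg_j : 'cV[R]_n;
  cg_rave : R;
  cg_jave : R;
  cg_r_ge0 : forall i : 'I_m, 0 <= cg_r i 0;
  cg_r_incr : forall i k : 'I_m, (i < k)%N -> cg_r i 0 < cg_r k 0;
  cg_j_ge0 : forall k : 'I_n, 0 <= cg_j k 0;
  cg_j_incr : forall i k : 'I_n, (i < k)%N -> cg_j i 0 < cg_j k 0;
  cg_active : cg_rave < \big[Num.max/0]_(i < m) cg_r i 0 \/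
              cg_jave < \big[Num.max/0]_(k < n) cg_j k 0
}.

Definition strategies (R : realType) (k : nat) (c : 'cV[R]_k) (cave : R) :
    set 'cV[R]_k :=
  [set x | [/\ lev 0 x,
               \sum_(i < k) x i 0 = 1
             & dotv c x <= cave]].

Definition Xhat (R : realType) (m n : nat) (G : constrained_game R m n) :
    set 'cV[R]_m :=
  strategies (cg_r G) (cg_rave G).

Definition Yhat (R : realType) (m n : nat) (G : constrained_game R m n) :
    set 'cV[R]_n :=
  strategies (cg_j G) (cg_jave G).

Definition nash_equilibrium (R : realType) (m n : nat)
  (G : constrained_game R m n) (xs : 'cV[R]_m) (ys : 'cV[R]_n) : Prop :=
  global_maximizer (Xhat G) (fun x => bilin x (cg_A G) ys) xs /\
  global_maximizer (Yhat G) (fun y => bilin xs (cg_B G) y) ys.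

Record qp_point (R : realType) (m n : nat) := QPPoint {
  qp_x : 'cV[R]_m;
  qp_y : 'cV[R]_n;
  qp_u : R;
  qp_v : R;
  qp_alpha : R;
  qp_beta : R
}.

Definition qp_objective (R : realType) (m n : nat)
  (G : constrained_game R m n) (p : qp_point R m n) : R :=
  bilin (qp_x p) (cg_A G + cg_B G) (qp_y p)
  - qp_u p * cg_rave G - qp_v p * cg_jave G - qp_alpha p - qp_beta p.

Record qp_constraints (R : realType) (m n : nat)
  (G : constrained_game R m n) (p : qp_point R m n) : Prop := QPConstraints {
  qp_rows : lev (cg_A G *m qp_y p - qp_u p *: cg_r G
                 - qp_alpha p *: ones R m) 0;
  qp_cols : lev ((cg_B G)^T *m qp_x p - qp_v p *: cg_j G
                 - qp_beta p *: ones R n) 0;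
  qp_rave : dotv (cg_r G) (qp_x p) <= cg_rave G;
  qp_jave : dotv (cg_j G) (qp_y p) <= cg_jave G;
  qp_sumx : dotv (ones R m) (qp_x p) = 1;
  qp_sumy : dotv (ones R n) (qp_y p) = 1;
  qp_x_ge0 : lev 0 (qp_x p);
  qp_y_ge0 : lev 0 (qp_y p);
  qp_u_ge0 : 0 <= qp_u p;
  qp_v_ge0 : 0 <= qp_v p
}.

Definition qp_feasible (R : realType) (m n : nat)
  (G : constrained_game R m n) : set (qp_point R m n) :=
  [set p | qp_constraints G p].

(* Main.v *)
Require Import Defs.
From mathcomp Require Import boolp classical_sets reals.
(* After [classical_sets], so that [setP], [setDUl] and the like are those of finset. *)
From mathcomp Require Import all_boot all_order all_algebra.
From mathcomp Require Import ring lra.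

(* Summing the constraints against x and y shows that the objective is at most 0
   on the feasible set.  Linear programming duality for each player's best-response
   problem turns an equilibrium into a feasible point of value 0, and a feasible
   point of value 0 is an equilibrium.  For the converse one must know that the
   maximum is 0, that is, that an equilibrium exists as soon as both strategy sets
   are nonempty.  The constrained game reduces to the bimatrix game played on
   finitely many strategies that attain every linear maximum (unit vectors, and
   mixtures of two unit vectors that meet the constraint with equality).  A bimatrix
   game has an equilibrium by the Lemke-Howson parity argument: the vertices of the
   lexicographically perturbed best-response polytope of one player form a cycle
   modulo 2, the complements of those of the other player a cocycle, hence the
   number of completely labelled pairs is even, and the pair of origins is one of
   them. *)

Set Implicit Arguments.
Unset Strict Implicit.
Unset Printing Implicit Defensive.

Import Order.TTheory GRing.Theory Num.Theory.
Local Open Scope ring_scope.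

(** * Lexicographic order on row vectors *)

Section LexicographicOrder.
Variables (R : realFieldType) (K : nat).
Implicit Types w : 'rV[R]_K.

Definition lex_gt0 w : bool :=
  [exists i, (0 < w 0 i) && [forall j : 'I_K, (j < i)%N ==> (w 0 j == 0)]].

Definition lex_le w1 w2 : bool := (w1 == w2) || lex_gt0 (w2 - w1).

Lemma lex_gt0P w :
  reflect (exists2 i, 0 < w 0 i & forall j : 'I_K, (j < i)%N -> w 0 j = 0)
          (lex_gt0 w).
Proof.
apply: (iffP existsP) => [[i /andP[wi /forallP w0]]|[i wi w0]]; exists i => //.
  by move=> j ji; apply/eqP; exact: (implyP (w0 j)).
by rewrite wi; apply/forallP => j; apply/implyP => /w0 ->.
Qed.

Lemma lex_gt0_neq0 w : lex_gt0 w -> w != 0.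
Proof.
by move=> /lex_gt0P[i wi _]; apply: contraTneq wi => ->; rewrite mxE ltxx.
Qed.

Lemma lex_gt0D w1 w2 : lex_gt0 w1 -> lex_gt0 w2 -> lex_gt0 (w1 + w2).
Proof.
move=> /lex_gt0P[i wi w10] /lex_gt0P[j wj w20]; apply/lex_gt0P.
case: (ltngtP i j) => ij.
- exists i => [|k ki]; rewrite !mxE; first by rewrite w20 // addr0.
  by rewrite w10 // w20 ?addr0 // (ltn_trans ki).
- exists j => [|k kj]; rewrite !mxE; first by rewrite w10 // add0r.
  by rewrite w20 // w10 ?addr0 // (ltn_trans kj).
- have eij : i = j by apply: val_inj.
  subst j; exists i => [|k ki]; rewrite !mxE; first exact: addr_gt0.
  by rewrite w10 // w20 // addr0.
Qed.

Lemma lex_gt0Z a w : 0 < a -> lex_gt0 (a *: w) = lex_gt0 w.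
Proof.
move=> a0; apply/lex_gt0P/lex_gt0P => -[i wi w0]; exists i.
- by move: wi; rewrite mxE pmulr_rgt0.
- move=> j /w0; rewrite mxE => /eqP.
  by rewrite mulf_eq0 gt_eqF //= => /eqP.
- by rewrite mxE pmulr_rgt0.
- by move=> j /w0; rewrite mxE => ->; rewrite mulr0.
Qed.

Lemma lex_gt0_total w : w != 0 -> lex_gt0 w || lex_gt0 (- w).
Proof.
move=> /rV0Pn[i0 wi0].
case: (arg_minnP (P := fun i => w 0 i != 0) (fun i : 'I_K => i) wi0) => i wi min_i.
have w0 (j : 'I_K) : (j < i)%N -> w 0 j = 0.
  by move=> ji; apply: contraTeq ji => /min_i; rewrite -leqNgt.
apply/orP; case: (ltrgtP 0 (w 0 i)) => [gt0|lt0|eq0].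
- by left; apply/lex_gt0P; exists i.
- right; apply/lex_gt0P; exists i => [|j /w0]; rewrite mxE ?oppr_gt0 //.
  by move=> ->; rewrite oppr0.
- by rewrite -eq0 eqxx in wi.
Qed.

Lemma lex_le_refl : reflexive lex_le.
Proof. by move=> w; rewrite /lex_le eqxx. Qed.

Lemma lex_le_trans : transitive lex_le.
Proof.
move=> w2 w1 w3 /predU1P[->//|h12] /predU1P[<-|h23]; apply/orP; right => //.
by have := lex_gt0D h23 h12; rewrite subrKA.
Qed.

Lemma lex_le_total : total lex_le.
Proof.
move=> w1 w2; have [->|ne] := eqVneq w1 w2; first by rewrite lex_le_refl.
have : w2 - w1 != 0 by rewrite subr_eq0 eq_sym.
by move=> /lex_gt0_total; rewrite opprB /lex_le => /orP[]->; rewrite !orbT.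
Qed.

Lemma lex_le_anti : antisymmetric lex_le.
Proof.
move=> w1 w2 /andP[/predU1P[//|h12] /predU1P[//|h21]].
by have /lex_gt0_neq0 := lex_gt0D h12 h21; rewrite addrC subrKA subrr eqxx.
Qed.

Lemma lex_le0D w1 w2 : lex_le 0 w1 -> lex_le 0 w2 -> lex_le 0 (w1 + w2).
Proof.
move=> /predU1P[<-|h1]; first by rewrite add0r.
move=> /predU1P[<-|h2]; first by rewrite addr0 /lex_le h1 orbT.
by rewrite subr0 in h1; rewrite subr0 in h2; rewrite /lex_le subr0 lex_gt0D // orbT.
Qed.

Lemma lex_le0Z a w : 0 <= a -> lex_le 0 w -> lex_le 0 (a *: w).
Proof.
rewrite le_eqVlt => /predU1P[<-|a0]; first by rewrite scale0r lex_le_refl.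
move=> /predU1P[<-|]; first by rewrite scaler0 lex_le_refl.
by rewrite /lex_le !subr0 lex_gt0Z // => ->; rewrite orbT.
Qed.

Lemma lex_le_sub0 w1 w2 : lex_le 0 (w2 - w1) = lex_le w1 w2.
Proof. by rewrite /lex_le subr0 eq_sym subr_eq0 eq_sym. Qed.

Lemma lex_leZ a w1 w2 : 0 < a -> lex_le (a *: w1) (a *: w2) = lex_le w1 w2.
Proof.
move=> a0; rewrite -lex_le_sub0 -scalerBr -[RHS]lex_le_sub0.
apply/idP/idP; last exact/lex_le0Z/ltW.
move=> /(@lex_le0Z a^-1); rewrite scalerA mulVf ?gt_eqF // scale1r.
by apply; rewrite invr_ge0 ltW.
Qed.

End LexicographicOrder.

(** The leading coordinate decides first: this recovers unperturbed inequalities from perturbed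
    ones. *)
Lemma lex_le0_head (R : realFieldType) K (w : 'rV[R]_(1 + K)) :
  lex_le 0 w -> 0 <= w 0 (lshift K ord0).
Proof.
move=> /predU1P[<-|]; first by rewrite mxE.
rewrite subr0 => /lex_gt0P[i wi w0]; have [->|ne] := eqVneq (lshift K ord0) i.
  exact: ltW.
by rewrite w0 // lt0n; apply: contraNneq ne => i0; apply/eqP/val_inj.
Qed.

(** * Vertices of a lexicographically perturbed polytope *)

Section IndependentRows.
Variables (R : fieldType) (N m : nat) (A : 'M[R]_(N, m)).

Definition independent_rows (T : {set 'I_N}) : Prop :=
  forall c : 'rV[R]_N, (forall l, l \notin T -> c 0 l = 0) -> c *m A = 0 -> c = 0.

Variable T : {set 'I_N}.
Hypothesis T_indep : independent_rows T.
Let A_T : 'M[R]_(#|T|, m) := rowsub (@enum_val _ (mem T)) A.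

Let A_T_free : row_free A_T.
Proof.
apply: inj_row_free => v vA.
pose c : 'rV[R]_N := v *m rowsub (@enum_val _ (mem T)) 1%:M.
have cE k : c 0 (enum_val k) = v 0 k.
  rewrite mxE (bigD1 k) //= !mxE eqxx mulr1 big1 ?addr0 // => i ik.
  by rewrite !mxE (inj_eq enum_val_inj) (negbTE ik) mulr0.
have c0 : c = 0.
  apply: T_indep => [l lT|].
    rewrite mxE big1 // => i _; rewrite !mxE.
    case: eqVneq => [el|]; last by rewrite mulr0.
    by move: lT; rewrite -el (enum_valP i).
  by rewrite -mulmxA mul_rowsub_mx mul1mx.
by apply/rowP => k; rewrite -cE c0 !mxE.
Qed.

Lemma independent_rows_card : (#|T| <= m)%N.
Proof. by rewrite -(eqP A_T_free) rank_leq_col. Qed.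

Hypothesis card_T : #|T| = m.

Lemma independent_rows_inj p (z : 'M[R]_(m, p)) :
  (forall l, l \in T -> row l (A *m z) = 0) -> z = 0.
Proof.
move=> Az; have full : row_full A_T by rewrite /row_full (eqP A_T_free) card_T.
rewrite -[z]mul1mx -(mulVpmx full) -mulmxA [A_T *m z](_ : _ = 0) ?mulmx0 //.
apply/row_matrixP => k; rewrite mul_rowsub_mx row_rowsub row0.
by apply: Az; exact: enum_valP.
Qed.

Lemma independent_rows_dual r : r \in T ->
  exists d : 'cV[R]_m, forall l, l \in T -> (A *m d) l 0 = (l == r)%:R.
Proof.
move=> rT; exists (pinvmx A_T *m delta_mx (enum_rank_in rT r) 0) => l lT.
have rowE (d : 'cV[R]_m) k : (A *m d) (enum_val k) 0 = (A_T *m d) k 0.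
  by rewrite mul_rowsub_mx [RHS]mxE.
rewrite -[in LHS](enum_rankK_in rT lT) rowE.
rewrite mulmxA mulmxVp // mul1mx !mxE eqxx andbT.
congr (_%:R); congr nat_of_bool; apply/eqP/eqP => [e|->//].
by rewrite -(enum_rankK_in rT lT) e enum_rankK_in.
Qed.

End IndependentRows.

Section LexicographicPolytope.
(* The polytope [A x <= b] with right-hand sides [(b_l, e_l)] ordered
   lexicographically, where [e_l] is the l-th unit vector: [e_l] stands for an
   infinitesimal perturbation of [b_l], which makes the polytope simple whatever
   [A] and [b] are.  Accordingly each coordinate of a point is a row of length
   [1 + N].  A vertex is represented by the set of its tight inequalities. *)
Variables (R : realFieldType) (N m : nat) (A : 'M[R]_(N, m)) (b : 'cV[R]_N).

Definition lex_slack (x : 'M[R]_(m, 1 + N)) : 'M[R]_(N, 1 + N) :=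
  row_mx b 1%:M - A *m x.

Definition lex_feasible x : Prop := forall l, lex_le 0 (row l (lex_slack x)).

Definition lex_tight x : {set 'I_N} := [set l | row l (lex_slack x) == 0].

Definition lex_vertex (T : {set 'I_N}) : bool :=
  (#|T| == m) && `[< exists2 x, lex_feasible x & lex_tight x = T >].

(** A relation among the tight rows also annihilates the right-hand sides [(b | I)], and the
    identity block forces it to be zero. This is where the perturbation acts. *)
Lemma lex_tight_independent x : independent_rows A (lex_tight x).
Proof.
move=> c c_out cA.
have c_slack : c *m lex_slack x = 0.
  rewrite mulmx_sum_row big1 // => l _.
  have [|/c_out ->] := boolP (l \in lex_tight x); last by rewrite scale0r.
  by rewrite inE => /eqP ->; rewrite scaler0.
move: c_slack; rewrite mulmxBr mulmxA cA mul0mx subr0 mul_mx_row mulmx1.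
by rewrite -[0]row_mx0 => /eq_row_mx[].
Qed.

Lemma lex_slackD x y : lex_slack (x + y) = lex_slack x - A *m y.
Proof. by rewrite /lex_slack mulmxDr opprD addrA. Qed.

Hypothesis A_bounded : forall d : 'cV[R]_m, d != 0 -> exists l, 0 < (A *m d) l 0.

(* The edge leaving a vertex along [S] carries exactly one other vertex: the
   lexicographic ratio test has a single minimizer. *)
Lemma lex_vertex_exchange (S : {set 'I_N}) r : r \notin S -> lex_vertex (r |: S) ->
  exists q, [/\ q \notin S, q != r
    & forall l, l \notin S -> lex_vertex (l |: S) = (l \in [set r; q])].
Proof.
move=> rS /andP[/eqP cardT /asboolP[x x_feas x_tight]].
have indep := @lex_tight_independent x; rewrite x_tight in indep.
have [d0 d0P] := independent_rows_dual indep (setU11 r S).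
(* Along [d] the slack of [r] grows at unit rate and the constraints in [S] stay tight. *)
pose d := - d0.
have dr : (A *m d) r 0 = -1 by rewrite mulmxN mxE d0P ?setU11 // eqxx.
have dS l : l \in S -> (A *m d) l 0 = 0.
  move=> lS; rewrite mulmxN mxE d0P ?setU1r // [l == r](_ : _ = false) ?oppr0 //.
  by apply: contraNF rS => /eqP <-.
have slack_ray w l : row l (lex_slack (x + d *m w)) =
    row l (lex_slack x) - (A *m d) l 0 *: w.
  rewrite lex_slackD mulmxA raddfB /= row_mul; congr (_ - _).
  apply/rowP => j; rewrite !mxE big_ord1 mxE; congr (_ * _).
  by rewrite !mxE.
have d_neq0 : d != 0.
  apply: contra_eqN dr => /eqP ->.
  by rewrite mulmx0 mxE eq_sym oppr_eq0 oner_eq0.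
have [l0 l0P] := A_bounded d_neq0.
pose ratio l := ((A *m d) l 0)^-1 *: row l (lex_slack x).
have [q q_gt0 q_min] := extremumP (P := fun l => 0 < (A *m d) l 0) ratio
  (@lex_le_refl R _) (@lex_le_trans R _) (@lex_le_total R _) l0P.
pose w := ratio q; pose x' := x + d *m w.
have qT : q \notin r |: S.
  rewrite !inE negb_or; apply/andP; split.
    by apply: contraTneq q_gt0 => ->; rewrite dr -leNgt lerN10.
  by apply: contraTN q_gt0 => qS; rewrite dS ?ltxx.
have q_out : q \notin S by apply: contraNN qT => qS; rewrite setU1r.
have w_gt0 : lex_gt0 w.
  have := x_feas q; rewrite /lex_le subr0 eq_sym.
  move: qT; rewrite -x_tight inE => /negbTE -> /=.
  by rewrite /w /ratio lex_gt0Z // invr_gt0.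
have w_ge0 : lex_le 0 w by rewrite /lex_le subr0 w_gt0 orbT.
have x'_feas : lex_feasible x'.
  move=> l; rewrite slack_ray; case: (ltrP 0 ((A *m d) l 0)) => [gt0|le0].
    by rewrite lex_le_sub0 -(lex_leZ _ _ (a := ((A *m d) l 0)^-1)) ?invr_gt0 //
      scalerA mulVf ?gt_eqF // scale1r; exact: q_min.
  rewrite -scaleNr; apply: lex_le0D (x_feas l) _.
  by apply: lex_le0Z => //; rewrite oppr_ge0.
have slack_tight l : l \in r |: S -> row l (lex_slack x) = 0.
  by rewrite -x_tight inE => /eqP.
have x'_tight : lex_tight x' = q |: S.
  apply/esym/eqP; rewrite eqEcard; apply/andP; split.
    apply/fintype.subsetP => l; rewrite !inE slack_ray => /predU1P[->|lS].
      by rewrite scalerA divff ?gt_eqF // scale1r subrr.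
    by rewrite dS // scale0r subr0 slack_tight // setU1r.
  (* A tie in the ratio test would make more than [m] independent rows tight. *)
  rewrite (leq_trans (independent_rows_card (@lex_tight_independent x'))) //.
  by rewrite -cardT !cardsU1 rS q_out.
exists q; split=> //; first by apply: contraNneq qT => ->; rewrite setU11.
move=> l lS; rewrite !inE; apply/idP/idP; last first.
  case/predU1P=> [->|/eqP ->]; rewrite /lex_vertex.
    by rewrite cardT eqxx; apply/asboolP; exists x.
  apply/andP; split; last by apply/asboolP; exists x'.
  by rewrite cardsU1 q_out -cardT cardsU1 rS.
case: eqVneq => //= lr /andP[_ /asboolP[y y_feas y_tight]].
(* The slack of [r] is the parameter along the edge, so a vertex [y] on it must be [x + d *m wy]. *)
pose wy := row r (lex_slack y).
have yE : y = x + d *m wy.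
  apply/eqP; rewrite -subr_eq0; apply/eqP.
  apply: (independent_rows_inj indep cardT) => k kT.
  have yk : row k (A *m y) = row k (row_mx b 1%:M) - row k (lex_slack y).
    by rewrite /lex_slack raddfB /= subKr.
  have xk : row k (A *m (x + d *m wy)) =
      row k (row_mx b 1%:M) - row k (lex_slack (x + d *m wy)).
    by rewrite /lex_slack raddfB /= subKr.
  rewrite mulmxBr raddfB /= yk xk opprB addrC addrA subrK slack_ray.
  rewrite slack_tight // sub0r.
  have := kT; rewrite !inE => /predU1P[->|kS].
    by rewrite dr scaleN1r opprK subrr.
  rewrite dS // scale0r oppr0 sub0r.
  have : k \in lex_tight y by rewrite y_tight setU1r.
  by rewrite inE => /eqP ->; rewrite oppr0.
have l_out : l \notin lex_tight x by rewrite x_tight !inE negb_or lr.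
have wy_ge0 : lex_le 0 wy by exact: y_feas.
have sl_gt0 : lex_gt0 (row l (lex_slack x)).
  have := x_feas l; rewrite /lex_le subr0 eq_sym.
  by move: l_out; rewrite inE => /negbTE ->.
have l_eq : row l (lex_slack x) = (A *m d) l 0 *: wy.
  have : l \in lex_tight y by rewrite y_tight setU11.
  by rewrite inE yE slack_ray subr_eq0 => /eqP.
have l_gt0 : 0 < (A *m d) l 0.
  rewrite ltNge; apply/negP => le0.
  have := lex_le0Z (_ : 0 <= - (A *m d) l 0) wy_ge0.
  rewrite oppr_ge0 scaleNr -l_eq => /(_ le0) /predU1P[/esym/eqP|].
    by rewrite oppr_eq0 (negbTE (lex_gt0_neq0 sl_gt0)).
  rewrite subr0 => /(lex_gt0D sl_gt0); rewrite subrr => /lex_gt0_neq0.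
  by rewrite eqxx.
(* Feasibility of [y] at [q] gives [wy <= w]; minimality of the ratio of [q] gives the converse. *)
have wyw : wy = w.
  apply: lex_le_anti; apply/andP; split.
    have := y_feas q; rewrite yE slack_ray lex_le_sub0.
    by rewrite -(lex_leZ _ _ (a := ((A *m d) q 0)^-1)) ?invr_gt0 //
      scalerA mulVf ?gt_eqF // scale1r.
  have := q_min _ l_gt0; rewrite {2}/ratio l_eq scalerA mulVf ?gt_eqF //.
  by rewrite scale1r.
have : l \in q |: S by rewrite -x'_tight /x' -wyw -yE y_tight setU11.
by rewrite !inE (negbTE lS) orbF.
Qed.

(** Each [S] has 0 or 2 completions to a vertex, so the vertices form a cycle modulo 2. *)
Lemma lex_vertex_parity (S : {set 'I_N}) :
  \big[addb/false]_(l | l \notin S) lex_vertex (l |: S) = false.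
Proof.
case: (pickP (fun r => (r \notin S) && lex_vertex (r |: S))) => [r /andP[rS rV]|none].
  have [q [qS qr VE]] := lex_vertex_exchange rS rV.
  rewrite (bigD1 r) //= (bigD1 q) /=; last by rewrite qS.
  rewrite !VE // !inE eqxx eqxx orbT big1 // => l /andP[/andP[lS lr] lq].
  by rewrite VE // !inE (negbTE lr) (negbTE lq).
by rewrite big1 // => l lS; have := none l; rewrite lS.
Qed.
End LexicographicPolytope.

(** * Equilibria of bimatrix games *)

(* Modulo 2, a cycle [a] is the boundary of the cone of [a] with apex [w], so its
   pairing with the cocycle [c] vanishes. *)
Lemma cycle_cocycle_pairing (V : finType) (a c : {set V} -> bool) (w : V) :
    (forall S : {set V}, \big[addb/false]_(x | x \notin S) a (x |: S) = false) ->
    (forall T : {set V}, \big[addb/false]_(x in T) c (T :\ x) = false) ->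
  \big[addb/false]_(S : {set V}) (a S && c S) = false.
Proof.
move=> cyc cocyc.
(* The cocycle condition at [w |: S], solved for its term [c S]. *)
have c_cone (S : {set V}) : w \notin S ->
    c S = \big[addb/false]_(x in S) c (w |: (S :\ x)).
  move=> wS; have := cocyc (w |: S).
  rewrite big_setU1 //= setU1K // => /(canRL (addbK _)) ->; rewrite addFb.
  apply: eq_bigr => x xS; congr c; rewrite setDUl; congr (_ :|: _).
  by apply/setDidPl; rewrite disjoints1 in_set1; apply: contraNneq wS => ->.
have without : \big[addb/false]_(S : {set V} | w \notin S) (a S && c S) =
    \big[addb/false]_(S : {set V} | w \notin S)
      \big[addb/false]_(x in S) (a S && c (w |: (S :\ x))).
  by apply: eq_bigr => S /c_cone ->; rewrite big_distrr.
have exch : \big[addb/false]_(S : {set V} | w \notin S)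
      \big[addb/false]_(x in S) (a S && c (w |: (S :\ x))) =
    \big[addb/false]_(S : {set V} | w \notin S)
      \big[addb/false]_(x | (x \notin S) && (x != w)) (a (x |: S) && c (w |: S)).
  rewrite !pair_big_dep /=.
  rewrite (reindex_onto (fun p => (p.2 |: p.1, p.2)) (fun p => (p.1 :\ p.2, p.2))) /=.
    apply: eq_big => [[S x]|[S x]] /=.
      rewrite xpair_eqE eqxx !inE eqxx /= !andbT negb_or eq_sym.
      case: (boolP (x \in S)) => xS; last by rewrite setU1K // eqxx andbT andbC.
      rewrite andbF; apply/negbTE; rewrite negb_and; apply/orP; right.
      by apply: contraTneq xS => <-; rewrite !inE eqxx.
    by move=> /andP[/andP[_ _]]; rewrite xpair_eqE => /andP[/eqP -> _].
  by case=> S x /= /andP[_ xS]; rewrite setD1K.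
have with_w : \big[addb/false]_(S : {set V} | w \in S) (a S && c S) =
    \big[addb/false]_(S : {set V} | w \notin S) (a (w |: S) && c (w |: S)).
  rewrite (reindex_onto (fun S => w |: S) (fun S => S :\ w)) /=; last first.
    by move=> S wS; rewrite setD1K.
  apply: eq_bigl => S; rewrite setU11 /=; apply/eqP/idP => [<-|wS].
    by rewrite !inE eqxx.
  exact: setU1K.
(* Each [S] without [w] now contributes [c (w |: S)] times the sum of [a (x |: S)] over all [x]
   outside [S]; the sets containing [w] supply the term [x = w]. *)
rewrite (bigID (fun S : {set V} => w \in S)) /= without exch with_w -big_split.
rewrite big1 // => S wS /=.
have := cyc S; rewrite (bigD1 w wS) /= => cycS.
by rewrite -big_distrl -andb_addl /= cycS.
Qed.

Lemma lex_vertex_point (R : realFieldType) N m (A : 'M[R]_(N, m)) b T :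
  lex_vertex A b T -> exists x : 'cV[R]_m,
    (forall l, (A *m x) l 0 <= b l 0) /\ (forall l, l \in T -> (A *m x) l 0 = b l 0).
Proof.
move=> /andP[_ /asboolP[x x_feas x_tight]].
exists (col (lshift N ord0) x).
have slackE l : row l (lex_slack A b x) 0 (lshift N ord0) =
    b l 0 - (A *m col (lshift N ord0) x) l 0.
  rewrite [LHS]mxE [LHS]mxE row_mxEl; congr (_ + _).
  by rewrite !mxE; congr (- _); apply: eq_bigr => i _; rewrite mxE.
split=> l; first by have := lex_le0_head (x_feas l); rewrite slackE subr_ge0.
by rewrite -x_tight inE => /eqP lT; apply/esym/eqP; rewrite -subr_eq0 -slackE lT mxE.
Qed.

Section BestResponsePolytope.
(* [{x >= 0, M x <= 1}] for a positive matrix [M]: the labels in [X] carry the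
   sign constraints, the other ones the rows of [M]. *)
Variables (R : realFieldType) (N k : nat) (P : 'M[R]_(N, k)) (p : 'cV[R]_N).
Variable (f : 'I_k -> 'I_N).
Let X := f @: [set: 'I_k].
Hypothesis f_inj : injective f.
Hypothesis P_sign : forall i j, P (f i) j = - (i == j)%:R.
Hypothesis p_sign : forall i, p (f i) 0 = 0.
Hypothesis P_gt0 : forall l j, l \notin X -> 0 < P l j.
Hypothesis p_one : forall l, l \notin X -> p l 0 = 1.

Let card_X : #|X| = k.
Proof. by rewrite card_imset // cardsT card_ord. Qed.

Let mulP_sign q (x : 'M[R]_(k, q)) i j : (P *m x) (f i) j = - x i j.
Proof.
rewrite mxE (bigD1 i) //= P_sign eqxx mulN1r big1 ?addr0 // => l li.
by rewrite P_sign eq_sym (negbTE li) oppr0 mul0r.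
Qed.

(** A direction with a negative coordinate breaks a sign constraint; a nonzero nonnegative one
    increases every positive row. *)
Lemma best_response_bounded : ~: X != set0 ->
  forall d : 'cV[R]_k, d != 0 -> exists l, 0 < (P *m d) l 0.
Proof.
move=> /set0Pn[l]; rewrite inE => lX d /cV0Pn[i di].
case: (pickP (fun i => d i 0 < 0)) => [j dj|d_ge0].
  by exists (f j); rewrite mulP_sign oppr_gt0.
have {}d_ge0 j : 0 <= d j 0 by rewrite leNgt d_ge0.
exists l; rewrite mxE (bigD1 i) //= ltr_pwDl //.
  by rewrite mulr_gt0 ?P_gt0 // lt_neqAle eq_sym di d_ge0.
by apply: sumr_ge0 => j _; rewrite mulr_ge0 // ltW // P_gt0.
Qed.

Lemma best_response_origin : lex_vertex P p X.
Proof.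
rewrite /lex_vertex card_X eqxx /=; apply/asboolP.
(* Solves the perturbed sign constraints with equality: the origin up to infinitesimals. *)
pose x : 'M[R]_(k, 1 + N) := - \matrix_i row (f i) (row_mx p 1%:M).
have tight_f i : row (f i) (lex_slack P p x) = 0.
  apply/rowP => j; rewrite [LHS]mxE [lex_slack _ _ _ _ _]mxE.
  rewrite [(- _ : 'M__) _ _]mxE mulP_sign opprK.
  by rewrite [x _ _]mxE [(\matrix__ _) _ _]mxE [row _ _ _ _]mxE subrr [RHS]mxE.
have head l : l \notin X -> row l (lex_slack P p x) 0 (lshift N ord0) = 1.
  move=> lX; rewrite [LHS]mxE [LHS]mxE row_mxEl p_one // [(- _ : 'M__) _ _]mxE.
  rewrite mxE big1 ?subr0 // => i _; rewrite [x _ _]mxE [(\matrix__ _) _ _]mxE.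
  by rewrite [row _ _ _ _]mxE row_mxEl p_sign oppr0 mulr0.
exists x => [l|].
  case: (boolP (l \in X)) => [/imsetP[i _ ->]|lX].
    by rewrite tight_f lex_le_refl.
  apply/orP; right; rewrite subr0; apply/lex_gt0P; exists (lshift N ord0) => //.
  by rewrite head.
apply/setP => l; rewrite inE; case: (boolP (l \in X)) => [/imsetP[i _ ->]|lX].
  by rewrite tight_f eqxx.
apply: contraTF isT => /eqP l0; have := head l lX; rewrite l0 mxE => /eqP.
by rewrite eq_sym oner_eq0.
Qed.

(** Were [x] zero, only sign constraints could be tight, so [T] would be contained in [X], and both
    have [k] elements. *)
Lemma best_response_vertex T : lex_vertex P p T -> T != X ->
  exists x : 'cV[R]_k, [/\ x != 0, forall i, 0 <= x i 0,
    forall l, (P *m x) l 0 <= p l 0 & forall l, l \in T -> (P *m x) l 0 = p l 0].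
Proof.
move=> vT TX; have [x [x_le x_eq]] := lex_vertex_point vT.
exists x; split=> // [|i]; last first.
  by have := x_le (f i); rewrite mulP_sign p_sign oppr_le0.
apply: contra_neq TX => x0; apply/eqP; rewrite eqEcard card_X.
have /andP[/eqP -> _] := vT; rewrite leqnn andbT.
apply/fintype.subsetP => l /x_eq; rewrite x0 mulmx0 mxE; apply: contra_eqT => lX.
by rewrite p_one // eq_sym oner_neq0.
Qed.

End BestResponsePolytope.

Lemma lemke_howson (R : realFieldType) m n (A B : 'M[R]_(m, n)) :
    (0 < m)%N -> (0 < n)%N ->
    (forall i j, 0 < A i j) -> (forall i j, 0 < B i j) ->
  exists (x : 'cV[R]_m) (y : 'cV[R]_n),
    [/\ x != 0 /\ forall i, 0 <= x i 0, y != 0 /\ forall j, 0 <= y j 0,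
        forall i, (A *m y) i 0 <= 1 /\ (x i 0 = 0 \/ (A *m y) i 0 = 1)
      & forall j, (B^T *m x) j 0 <= 1 /\ (y j 0 = 0 \/ (B^T *m x) j 0 = 1)].
Proof.
move=> m_gt0 n_gt0 A_gt0 B_gt0.
pose PX : 'M[R]_(m + n, m) := col_mx (- 1%:M) B^T.
pose pX : 'cV[R]_(m + n) := col_mx 0 (const_mx 1).
pose PY : 'M[R]_(m + n, n) := col_mx A (- 1%:M).
pose pY : 'cV[R]_(m + n) := col_mx (const_mx 1) 0.
pose X := @lshift m n @: [set: 'I_m]; pose Y := @rshift m n @: [set: 'I_n].
have inX i : lshift n i \in X by apply: imset_f; rewrite inE.
have inY j : rshift m j \in Y by apply: imset_f; rewrite inE.
have XY l : (l \in X) = (l \notin Y).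
  rewrite -[l]splitK; case: (split l) => [i|j] /=.
    by rewrite inX; apply/esym/imsetP => -[j _ /eqP]; rewrite eq_lrshift.
  by rewrite inY; apply/imsetP => -[i _ /eqP]; rewrite eq_rlshift.
have YE : Y = ~: X by apply/setP => l; rewrite inE XY negbK.
have PX_sign i j : PX (lshift n i) j = - (i == j)%:R by rewrite col_mxEu !mxE.
have pX_sign i : pX (lshift n i) 0 = 0 by rewrite col_mxEu mxE.
have PX_gt0 l j : l \notin X -> 0 < PX l j.
  by rewrite XY negbK => /imsetP[i _ ->]; rewrite col_mxEd mxE.
have pX_one l : l \notin X -> pX l 0 = 1.
  by rewrite XY negbK => /imsetP[i _ ->]; rewrite col_mxEd mxE.
have PY_sign i j : PY (rshift m i) j = - (i == j)%:R by rewrite col_mxEd !mxE.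
have pY_sign i : pY (rshift m i) 0 = 0 by rewrite col_mxEd mxE.
have PY_gt0 l j : l \notin Y -> 0 < PY l j.
  by rewrite -XY => /imsetP[i _ ->]; rewrite col_mxEu.
have pY_one l : l \notin Y -> pY l 0 = 1.
  by rewrite -XY => /imsetP[i _ ->]; rewrite col_mxEu mxE.
have XC0 : ~: X != set0.
  by apply/set0Pn; exists (rshift m (Ordinal n_gt0)); rewrite -YE.
have YC0 : ~: Y != set0.
  by apply/set0Pn; exists (lshift n (Ordinal m_gt0)); rewrite inE -XY.
have X_bounded := best_response_bounded PX_sign PX_gt0 XC0.
have Y_bounded := best_response_bounded PY_sign PY_gt0 YC0.
have parity := @cycle_cocycle_pairing _ (lex_vertex PX pX)
  (fun T => lex_vertex PY pY (~: T)) (lshift n (Ordinal m_gt0))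
  (fun S => lex_vertex_parity pX X_bounded S).
have [T /andP[vX vY] TX] : exists2 T,
    lex_vertex PX pX T && lex_vertex PY pY (~: T) & T != X.
  case: (pickP (fun T =>
    (lex_vertex PX pX T && lex_vertex PY pY (~: T)) && (T != X))) => [T|none].
    by move=> /andP[T1 T2]; exists T.
  have : true = false; last by [].
  rewrite -[RHS]parity.
    rewrite (bigD1 X) //= -YE.
    rewrite (best_response_origin (@lshift_inj _ _)) //.
    rewrite (best_response_origin (@rshift_inj _ _)) // big1 // => T TX.
    by have := none T; rewrite TX andbT.
  (* Removing [l] from [T] adds it to the complement, which turns the cycle condition into the
     cocycle one. *)
  move=> T; rewrite -[RHS](lex_vertex_parity pY Y_bounded (~: T)).
  apply: eq_big => l; first by rewrite inE negbK.
  by move=> _; rewrite setCD setUC.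
have [x [x0 x_ge0 x_le x_eq]] :=
  best_response_vertex (@lshift_inj _ _) PX_sign pX_sign pX_one vX TX.
have TY : ~: T != Y by rewrite YE (inj_eq (@setC_inj _)).
have [y [y0 y_ge0 y_le y_eq]] :=
  best_response_vertex (@rshift_inj _ _) PY_sign pY_sign pY_one vY TY.
exists x, y; split=> // [i|j].
  have Ay : (PY *m y) (lshift n i) 0 = (A *m y) i 0 by rewrite mul_col_mx col_mxEu.
  split; first by have := y_le (lshift n i); rewrite Ay col_mxEu [leRHS]mxE.
  (* Every label lies in [T] or in its complement, hence is tight for [x] or for [y]. *)
  have [/x_eq|iT] := boolP (lshift n i \in T).
    rewrite mul_col_mx mulNmx mul1mx !col_mxEu [LHS]mxE [RHS]mxE => /eqP.
    by rewrite oppr_eq0 => /eqP; left.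
  have := y_eq (lshift n i); rewrite inE iT => /(_ isT).
  by rewrite Ay col_mxEu [RHS]mxE; right.
have Bx : (PX *m x) (rshift m j) 0 = (B^T *m x) j 0 by rewrite mul_col_mx col_mxEd.
split; first by have := x_le (rshift m j); rewrite Bx col_mxEd [leRHS]mxE.
have [/x_eq|jT] := boolP (rshift m j \in T).
  by rewrite Bx col_mxEd [RHS]mxE; right.
have := y_eq (rshift m j); rewrite inE jT => /(_ isT).
rewrite mul_col_mx mulNmx mul1mx !col_mxEd [LHS]mxE [RHS]mxE => /eqP.
by rewrite oppr_eq0 => /eqP; left.
Qed.

(** Adding a constant to all payoffs makes them positive without changing best responses; the
    solution for positive payoffs is then normalised to sum 1. *)
Lemma bimatrix_equilibrium (R : realFieldType) m n (A B : 'M[R]_(m, n)) :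
    (0 < m)%N -> (0 < n)%N ->
  exists (x : 'cV[R]_m) (y : 'cV[R]_n) (a b : R),
    [/\ (forall i, 0 <= x i 0) /\ \sum_i x i 0 = 1,
        (forall j, 0 <= y j 0) /\ \sum_j y j 0 = 1,
        forall i, (A *m y) i 0 <= a /\ (x i 0 = 0 \/ (A *m y) i 0 = a)
      & forall j, (B^T *m x) j 0 <= b /\ (y j 0 = 0 \/ (B^T *m x) j 0 = b)].
Proof.
move=> m_gt0 n_gt0.
pose shift (M : 'M[R]_(m, n)) : R := 1 + \sum_i \sum_j `|M i j|.
have shift_gt0 (M : 'M[R]_(m, n)) i j : 0 < (M + const_mx (shift M)) i j.
  have : - M i j <= \sum_i \sum_j `|M i j|.
    rewrite (le_trans (ler_norm _)) // normrN (bigD1 i) //= (bigD1 j) //=.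
    by rewrite -addrA lerDl addr_ge0 ?sumr_ge0 // => k _; rewrite sumr_ge0.
  by rewrite !mxE /shift; lra.
have [x [y [[x0 x_ge0] [y0 y_ge0] Ay Bx]]] :=
  lemke_howson m_gt0 n_gt0 (shift_gt0 A) (shift_gt0 B).
have sum_gt0 k (z : 'cV[R]_k) : z != 0 -> (forall i, 0 <= z i 0) -> 0 < \sum_i z i 0.
  move=> /cV0Pn[i zi] z_ge0; rewrite (bigD1 i) //= ltr_pwDl ?sumr_ge0 //.
  by rewrite lt_neqAle eq_sym zi z_ge0.
pose s : R := \sum_i x i 0; pose t : R := \sum_j y j 0.
have s_gt0 : 0 < s by exact: sum_gt0.
have t_gt0 : 0 < t by exact: sum_gt0.
have shiftE k l (M : 'M[R]_(k, l)) c (z : 'cV[R]_l) i :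
    ((M + const_mx c) *m z) i 0 = (M *m z) i 0 + c * \sum_j z j 0.
  rewrite mulmxDl [LHS]mxE; congr (_ + _).
  by rewrite mxE mulr_sumr; apply: eq_bigr => j _; rewrite mxE.
have AyE i : (A *m (t^-1 *: y)) i 0 =
    t^-1 * ((A + const_mx (shift A)) *m y) i 0 - shift A.
  by rewrite shiftE -scalemxAr [LHS]mxE -/t mulrDr mulrCA mulVf ?gt_eqF // mulr1 addrK.
have BxE j : (B^T *m (s^-1 *: x)) j 0 =
    s^-1 * ((B + const_mx (shift B))^T *m x) j 0 - shift B.
  rewrite linearD /= trmx_const shiftE -scalemxAr [LHS]mxE -/s mulrDr mulrCA.
  by rewrite mulVf ?gt_eqF // mulr1 addrK.
exists (s^-1 *: x), (t^-1 *: y), (t^-1 - shift A), (s^-1 - shift B); split.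
- split=> [i|]; first by rewrite mxE mulr_ge0 // invr_ge0 ltW.
  under eq_bigr do rewrite mxE.
  by rewrite -mulr_sumr mulVf // gt_eqF.
- split=> [j|]; first by rewrite mxE mulr_ge0 // invr_ge0 ltW.
  under eq_bigr do rewrite mxE.
  by rewrite -mulr_sumr mulVf // gt_eqF.
- move=> i; have [le1 eq1] := Ay i; rewrite AyE; split.
    by rewrite lerD2r ler_piMr // invr_ge0 ltW.
  by case: eq1 => [xi|->]; [left; rewrite mxE xi mulr0|right; rewrite mulr1].
- move=> j; have [le1 eq1] := Bx j; rewrite BxE; split.
    by rewrite lerD2r ler_piMr // invr_ge0 ltW.
  by case: eq1 => [xi|->]; [left; rewrite mxE xi mulr0|right; rewrite mulr1].
Qed.

(** * Linear programming over one player's strategies *)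

Lemma dotvE (R : realType) k (a b : 'cV[R]_k) : dotv a b = \sum_i a i 0 * b i 0.
Proof. by rewrite /dotv mxE; apply: eq_bigr => i _; rewrite mxE. Qed.

Lemma dotvC (R : realType) k (a b : 'cV[R]_k) : dotv a b = dotv b a.
Proof. by rewrite !dotvE; apply: eq_bigr => i _; rewrite mulrC. Qed.

Lemma dotv_ones (R : realType) k (x : 'cV[R]_k) : dotv (ones R k) x = \sum_i x i 0.
Proof. by rewrite dotvE; apply: eq_bigr => i _; rewrite [ones _ _ _ _]mxE mul1r. Qed.

Lemma bilin_dotl (R : realType) m n x (M : 'M[R]_(m, n)) y :
  bilin x M y = dotv x (M *m y).
Proof. by rewrite /bilin /dotv mulmxA. Qed.

Lemma bilin_dotr (R : realType) m n x (M : 'M[R]_(m, n)) y :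
  bilin x M y = dotv (M^T *m x) y.
Proof. by rewrite /bilin /dotv trmx_mul trmxK. Qed.

Section Strategies.
Variables (R : realType) (k : nat) (r : 'cV[R]_k) (rave : R).
Local Notation X := (strategies r rave).

(* The intercept and slope of a line through (rave, val) lying above all the
   points (r_i, c_i); the hypotheses only involve the points and segments that
   the constraint allows. *)
Lemma supporting_line (c : 'cV[R]_k) (val : R) :
    (forall i, r i 0 <= rave -> c i 0 <= val) ->
    (forall i l, r i 0 < rave -> rave < r l 0 ->
       c i 0 * (r l 0 - rave) + c l 0 * (rave - r i 0) <= val * (r l 0 - r i 0)) ->
  exists2 u, 0 <= u & forall i, c i 0 <= val + u * (r i 0 - rave).
Proof.
move=> point segment.
pose slope l := if rave < r l 0 then (c l 0 - val) / (r l 0 - rave) else 0.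
(* Points beyond [rave] bound the slope from below, points before it from above; the segment
   hypothesis makes these bounds compatible. The initial value 0 keeps the slope nonnegative. *)
pose u := \big[Num.max/0]_l slope l.
have u_ge0 : 0 <= u by exact: bigmax_ge_id.
have slope_le l : slope l <= u by exact: le_bigmax.
exists u => // i; case: (ltgtP (r i 0) rave) => [lt|gt|eq]; last first.
- by rewrite eq subrr mulr0 addr0 point // eq.
- have := slope_le i; rewrite /slope gt ler_pdivrMr ?subr_gt0 //.
  by rewrite lerBlDl.
have : u <= (val - c i 0) / (rave - r i 0).
  apply: bigmax_le => [|l _].
    by rewrite divr_ge0 // subr_ge0 ?point // ltW.
  rewrite /slope; case: ifP => gt.
    rewrite ler_pdivrMr ?subr_gt0 // mulrAC ler_pdivlMr ?subr_gt0 //.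
    by have := segment _ _ lt gt; lra.
  by rewrite divr_ge0 // subr_ge0 ?point // ltW.
rewrite ler_pdivlMr ?subr_gt0 //; lra.
Qed.

(** Chosen so that, for [i] below and [l] above [rave], the mixture costs exactly [rave]. *)
Let mix_weight i l : R := (r l 0 - rave) / (r l 0 - r i 0).

(* For [i = l] the quotient above is [_ / 0 = 0], so this is the unit vector. *)
Let mix i l : 'cV[R]_k :=
  mix_weight i l *: delta_mx i 0 + (1 - mix_weight i l) *: delta_mx l 0.

Let mixable (i l : 'I_k) : bool := (r i 0 <= rave) && ((i == l) || (rave < r l 0)).

Let dotv_delta (c : 'cV[R]_k) i : dotv c (delta_mx i 0) = c i 0.
Proof.
rewrite dotvE (bigD1 i) //= mxE !eqxx mulr1 big1 ?addr0 // => j ji.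
by rewrite mxE (negbTE ji) mulr0.
Qed.

Let dotv_mix c i l :
  dotv c (mix i l) = mix_weight i l * c i 0 + (1 - mix_weight i l) * c l 0.
Proof.
by rewrite /mix -!(dotv_delta c) /dotv mulmxDr -!scalemxAr !mxE.
Qed.

Let mix_weight_itv i l : mixable i l -> 0 <= mix_weight i l <= 1.
Proof.
move=> /andP[ri /predU1P[->|rl]]; rewrite /mix_weight.
  by rewrite subrr invr0 mulr0 lexx ler01.
by rewrite divr_ge0 ?ler_pdivrMr ?subr_ge0 ?subr_gt0 /=; lra.
Qed.

Let mix_strategy i l : mixable i l -> X (mix i l).
Proof.
move=> il; have /andP[w0 w1] := mix_weight_itv il.
split.
- move=> j; rewrite !mxE.
  by rewrite addr_ge0 // mulr_ge0 ?subr_ge0 ?ler0n.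
- by rewrite -dotv_ones dotv_mix !mxE !mulr1 addrC subrK.
rewrite dotv_mix; have /andP[ri /predU1P[eil|rl]] := il.
  by rewrite -eil; apply: le_trans ri; lra.
suff -> : mix_weight i l * r i 0 + (1 - mix_weight i l) * r l 0 = rave by [].
by rewrite /mix_weight; field; lra.
Qed.

Lemma strategies_supporting_line (c : 'cV[R]_k) (val : R) :
    (forall i l, mixable i l -> dotv c (mix i l) <= val) ->
  exists2 u, 0 <= u & forall i, c i 0 <= val + u * (r i 0 - rave).
Proof.
move=> le_val; apply: supporting_line => [i ri|i l ri rl].
  have := le_val i i; rewrite /mixable ri eqxx => /(_ isT).
  by rewrite dotv_mix; lra.
have := le_val i l; rewrite /mixable (ltW ri) rl orbT => /(_ isT).
have dif : 0 < r l 0 - r i 0 by lra.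
rewrite dotv_mix -(ler_pM2r dif); congr (_ <= _).
by rewrite /mix_weight; field; lra.
Qed.

(** Averaging the line over [x] leaves the slope term [u * (dotv r x - rave)], which is
    nonpositive. *)
Lemma dotv_le_line (c : 'cV[R]_k) u a x : X x -> 0 <= u ->
  (forall i, c i 0 <= a + u * (r i 0 - rave)) -> dotv c x <= a.
Proof.
move=> [x0 x1 xr] u0 c_le.
apply: (@le_trans _ _ (a * \sum_i x i 0 + u * (dotv r x - rave * \sum_i x i 0))).
  rewrite !dotvE !mulr_sumr -sumrB mulr_sumr -big_split /= ler_sum // => i _.
  have xi : 0 <= x i 0 by have := x0 i; rewrite mxE.
  by apply: le_trans (ler_wpM2r xi (c_le i)) _; lra.
rewrite x1; nra.
Qed.

(** The supporting line at the optimal value is the dual solution: its slope is the multiplier [u]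
    of the cost constraint, its height at cost 0 is [a]. *)
Lemma strategies_duality (c x : 'cV[R]_k) : X x ->
    (forall x', X x' -> dotv c x' <= dotv c x) ->
  exists u a, [/\ 0 <= u, lev c (u *: r + a *: ones R k) & dotv c x = u * rave + a].
Proof.
move=> Xx x_max.
have [|u u0 c_le] := @strategies_supporting_line c (dotv c x).
  by move=> i l /mix_strategy; exact: x_max.
exists u, (dotv c x - u * rave); split=> //; last by rewrite addrC subrK.
by move=> i; rewrite !mxE; have := c_le i; lra.
Qed.

(** A bound on the finitely many mixtures yields a supporting line, and the line bounds every
    strategy. *)
Lemma strategies_vertices : exists p (V : 'M[R]_(p, k)),
  (forall q, X (row q V)^T) /\
  forall (c : 'cV[R]_k) val, (forall q, (V *m c) q 0 <= val) ->
    forall x, X x -> dotv c x <= val.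
Proof.
pose P := [set il : 'I_k * 'I_k | mixable il.1 il.2].
pose v (q : 'I_#|P|) := mix (enum_val q).1 (enum_val q).2.
exists #|P|, (\matrix_q (v q)^T); split=> [q|c val c_le x Xx].
  by rewrite rowK trmxK; apply: mix_strategy; have := enum_valP q; rewrite inE.
have vE q : (\matrix_q (v q)^T *m c) q 0 = dotv c (v q).
  rewrite dotvE mxE; apply: eq_bigr => j _.
  by rewrite [(\matrix__ _) _ _]mxE [(_^T) _ _]mxE mulrC.
have [i l il|u u0 c_line] := @strategies_supporting_line c val.
  have ilP : (i, l) \in P by rewrite inE.
  by have := c_le (enum_rank_in ilP (i, l)); rewrite vE /v enum_rankK_in.
exact: dotv_le_line Xx u0 c_line.
Qed.

End Strategies.

(** * The quadratic program *)

Lemma strategies_convex (R : realType) k (r : 'cV[R]_k) rave p (V : 'M[R]_(p, k))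
    (w : 'cV[R]_p) :
    (forall q, strategies r rave (row q V)^T) ->
    (forall q, 0 <= w q 0) -> \sum_q w q 0 = 1 ->
  strategies r rave (V^T *m w).
Proof.
move=> VX w_ge0 w_sum.
have dotV c : dotv c (V^T *m w) = \sum_q w q 0 * dotv c (row q V)^T.
  transitivity (dotv w (V *m c)); last first.
    rewrite dotvE; apply: eq_bigr => q _; congr (_ * _).
    by rewrite dotvC /dotv trmxK -row_mul [row _ _ _ _]mxE.
  by rewrite dotvC /dotv trmx_mul trmxK mulmxA.
split.
- move=> i; rewrite !mxE sumr_ge0 // => q _; rewrite mulr_ge0 // mxE.
  by have [/(_ i)] := VX q; rewrite !mxE.
- rewrite -dotv_ones dotV -w_sum; apply: eq_bigr => q _.
  by have [_ x1 _] := VX q; rewrite dotv_ones x1 mulr1.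
rewrite dotV -[rave]mul1r -w_sum mulr_suml ler_sum // => q _.
by rewrite ler_wpM2l //; have [] := VX q.
Qed.

Lemma complementary_dot (R : realType) k (x z : 'cV[R]_k) a :
    \sum_i x i 0 = 1 -> (forall i, z i 0 <= a /\ (x i 0 = 0 \/ z i 0 = a)) ->
  dotv x z = a.
Proof.
move=> x1 xz; rewrite dotvE -[RHS]mul1r -x1 mulr_suml; apply: eq_bigr => i _.
by have [_ [->|->]] := xz i; rewrite ?mul0r.
Qed.

Section ConstrainedGame.
Variables (R : realType) (m n : nat) (G : constrained_game R m n).

(** The rows of [V] and [W] serve as pure strategies; [V^T] and [W^T] turn mixtures of them back
    into constrained strategies. *)
Lemma nash_equilibrium_exists :
    (exists x, Xhat G x) -> (exists y, Yhat G y) ->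
  exists x y, nash_equilibrium G x y.
Proof.
move=> [x0 Xx0] [y0 Yy0].
have [p [V [VX V_max]]] := strategies_vertices (cg_r G) (cg_rave G).
have [q [W [WY W_max]]] := strategies_vertices (cg_j G) (cg_jave G).
(* With no rows, [V_max] would bound every linear form by 0, yet the entries of [x0] sum to 1. *)
have p_gt0 : (0 < p)%N.
  case: p V VX V_max => // V _ /(_ (ones R m) 0)/(_ _)/(_ _)/(_ Xx0) le0.
  have [_ x1 _] := Xx0; have := le0 (fun i => False_ind _ (notF (ltn_ord i))).
  by rewrite dotv_ones x1 ler10.
have q_gt0 : (0 < q)%N.
  case: q W WY W_max => // W _ /(_ (ones R n) 0)/(_ _)/(_ _)/(_ Yy0) le0.
  have [_ x1 _] := Yy0; have := le0 (fun i => False_ind _ (notF (ltn_ord i))).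
  by rewrite dotv_ones x1 ler10.
have [xi [eta [a [b [[xi_ge0 xi_sum] [eta_ge0 eta_sum] Aeta Bxi]]]]] :=
  bimatrix_equilibrium (V *m cg_A G *m W^T) (V *m cg_B G *m W^T) p_gt0 q_gt0.
exists (V^T *m xi), (W^T *m eta); split; split.
- exact: strategies_convex.
- have val : bilin (V^T *m xi) (cg_A G) (W^T *m eta) = a.
    rewrite -(complementary_dot xi_sum Aeta) /bilin /dotv.
    by rewrite trmx_mul trmxK !mulmxA.
  move=> x Xx; rewrite val bilin_dotl dotvC; apply: (V_max _ _ _ _ Xx) => i.
  by have [] := Aeta i; rewrite -!mulmxA.
- exact: strategies_convex.
- have val : bilin (V^T *m xi) (cg_B G) (W^T *m eta) = b.
    rewrite -(complementary_dot eta_sum Bxi) bilin_dotr dotvC /dotv.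
    by rewrite !trmx_mul !trmxK !mulmxA.
  move=> y Yy; rewrite val bilin_dotr; apply: (W_max _ _ _ _ Yy) => j.
  by have [] := Bxi j; rewrite !trmx_mul !trmxK -!mulmxA.
Qed.

Lemma weak_duality k (r c x : 'cV[R]_k) rave u a :
    strategies r rave x -> 0 <= u -> lev (c - u *: r - a *: ones R k) 0 ->
  dotv c x <= u * rave + a.
Proof.
move=> Xx u0 c_le; apply: dotv_le_line Xx u0 _ => i.
by have := c_le i; rewrite !mxE; lra.
Qed.

Lemma qp_feasible_strategies p : qp_feasible G p ->
  Xhat G (qp_x p) /\ Yhat G (qp_y p).
Proof. by case=> *; split; split=> //; rewrite -dotv_ones. Qed.

Lemma bilinD (x : 'cV[R]_m) (A B : 'M[R]_(m, n)) y :
  bilin x (A + B) y = bilin x A y + bilin x B y.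
Proof. by rewrite /bilin mulmxDr mulmxDl mxE. Qed.

(** The objective is the sum of the two duality gaps, each at most 0. *)
Lemma qp_objective_le0 p : qp_feasible G p -> qp_objective G p <= 0.
Proof.
move=> p_feas; have [Xx Yy] := qp_feasible_strategies p_feas.
case: p_feas => rows cols _ _ _ _ _ _ u0 v0.
have := weak_duality Xx u0 rows; have := weak_duality Yy v0 cols.
rewrite /qp_objective bilinD bilin_dotl (bilin_dotr _ (cg_B G)).
by rewrite (dotvC (qp_x p)); lra.
Qed.

(** Optimal dual solutions of the two best-response problems close both gaps. *)
Lemma nash_qp_zero x y : nash_equilibrium G x y ->
  exists u v a b, qp_feasible G (QPPoint x y u v a b) /\
                  qp_objective G (QPPoint x y u v a b) = 0.
Proof.
move=> [[Xx x_max] [Yy y_max]].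
have [|u [a [u0 Ay xAy]]] := strategies_duality (c := cg_A G *m y) Xx.
  by move=> x' /x_max; rewrite !bilin_dotl ![dotv (_ *m _) _]dotvC.
have [|v [b [v0 Bx xBy]]] := strategies_duality (c := (cg_B G)^T *m x) Yy.
  by move=> y' /y_max; rewrite !bilin_dotr.
exists u, v, a, b; split; last first.
  rewrite /qp_objective /= bilinD bilin_dotl (bilin_dotr _ (cg_B G)) dotvC xAy xBy.
  by lra.
have [x_ge0 x1 xr] := Xx; have [y_ge0 y1 yr] := Yy.
split=> //=; rewrite ?dotv_ones //.
- by move=> i; have := Ay i; rewrite !mxE; lra.
- by move=> j; have := Bx j; rewrite !mxE; lra.
Qed.

End ConstrainedGame.

Theorem theorem3 (R : realType) (m n : nat) (G : constrained_game R m n)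
    (xs : 'cV[R]_m) (ys : 'cV[R]_n) :
  nash_equilibrium G xs ys <->
  exists us vs alphas betas : R,
    [/\ 0 <= us, 0 <= vs
      & global_maximizer (qp_feasible G) (qp_objective G)
          (QPPoint xs ys us vs alphas betas)].
Proof.
split=> [/nash_qp_zero[u [v [a [b [feas zero]]]]]|].
  exists u, v, a, b; split; [exact: (qp_u_ge0 feas)|exact: (qp_v_ge0 feas)|].
  by split=> // q /qp_objective_le0; rewrite zero.
move=> [u [v [a [b [u0 v0 [feas p_max]]]]]].
have [Xx Yy] := qp_feasible_strategies feas.
have [x' [y' /nash_qp_zero[u' [v' [a' [b' [feas' zero']]]]]]] :=
  nash_equilibrium_exists (ex_intro _ xs Xx) (ex_intro _ ys Yy).
have := p_max _ feas'; rewrite zero' /qp_objective /= bilinD => obj_ge0.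
have rows := qp_rows feas; have cols := qp_cols feas.
have := weak_duality Xx u0 rows; have := weak_duality Yy v0 cols.
rewrite -bilin_dotr dotvC -bilin_dotl => /= xBy xAy.
(* Neither gap is positive and their sum is at least 0, so both vanish; the weak duality bound on
   [z] is thus attained by the given strategy. *)
split; (split=> // z Xz /=).
  by have := weak_duality Xz u0 rows; rewrite dotvC -bilin_dotl /=; lra.
by have := weak_duality Xz v0 cols; rewrite -bilin_dotr /=; lra.
Qed.
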